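(* Let $G$ be a finite group and let $f\in\mathbb{C}[G]$ be a nonnegative element. (a) There exists a unique nonnegative element $h\in\mathbb{C}[G]$ such that $h=h^*$ and $f=h^2$. (b) Let $h=\sum_{z\in G}C_h(z)z$ be the element from (a). The matrix $Q_h\in\mathbb{C}^{G\times G}$ defined by $Q_h(x,y)=C_h(x^{-1})C_h(y)$ for $x,y\in G$ is an optimal solution of the optimization problem $$\begin{aligned}\text{maximize}\quad & Q(1_G,1_G)\\ \text{subject to}\quad & Q\in\mathbb{C}^{G\times G},\ Q^{\mathsf H}=Q,\ Q\succeq 0,\\ & \sum_{(x,y)\in G\times G,\ x^{-1}y=z}Q(x,y)=C_f(z)\quad\text{for all } z\in G.\end{aligned}$$
   Context: For a finite group $G$ with identity $1_G$, $\mathbb{C}[G]$ is the complex group algebra; every $f\in\mathbb{C}[G]$ is written uniquely as $f=\sum_{x\in G}C_f(x)x$ with coefficient function $C_f:G\to\mathbb{C}$. The involution is $f^*=\sum_{x\in G}\overline{C_f(x)}\,x^{-1}$. A $*$-representation of $\mathbb{C}[G]$ is an algebra homomorphism $\pi:\mathbb{C}[G]\to\mathbb{C}^{n\times n}$ such that $\pi(x)$ is unitary for all $x\in G$ and $\pi(f^* )=\pi(f)^{\mathsf H}$ for all $f$, where $A^{\mathsf H}$ is the conjugate transpose. An element $f$ is nonnegative if $\pi(f)$ is (Hermitian) positive semidefinite for every $*$-representation $\pi$. $\mathbb{C}^{G\times G}$ is the space of complex matrices with rows and columns indexed by $G$, and $Q\succeq 0$ means positive semidefinite. *)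

(* Defs.v *)
From HB Require Import structures.
From mathcomp Require Import all_boot all_order all_fingroup all_algebra.

Set Implicit Arguments.
Unset Strict Implicit.
Unset Printing Implicit Defensive.

Import GroupScope GRing.Theory Num.Theory.
Local Open Scope ring_scope.
Local Open Scope sesquilinear_scope.

(* An element f of the group algebra C[G] is its coefficient function, so that
   f x is C_f(x). The alias hides the pointwise product that the library puts
   on {ffun G -> C}: here the product is the convolution. *)
Definition group_algebra (C : numClosedFieldType) (gT : finGroupType) : Type :=
  {ffun gT -> C}.

Section GroupAlgebra.
Variables (C : numClosedFieldType) (gT : finGroupType).
Local Notation A := (group_algebra C gT).

HB.instance Definition _ := GRing.Lmodule.copy A {ffun gT -> C^o}.

Definition group_elt (x : gT) : A := [ffun y => (y == x)%:R].

Definition group_algebra_mul (f g : A) : A :=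
  [ffun z => \sum_x f x * g (x^-1 * z)%g].

Lemma group_algebra_mulA : associative group_algebra_mul.
Proof.
move=> f g h; apply/ffunP=> z; rewrite !ffunE.
under eq_bigr => x _ do rewrite ffunE big_distrr /=.
under [RHS]eq_bigr => y _ do rewrite ffunE big_distrl /=.
rewrite [RHS]exchange_big /=; apply: eq_bigr => x _.
rewrite (reindex_inj (mulgI x^-1%g)) /=; apply: eq_bigr => y _.
by rewrite mulrA invMg invgK -mulgA mulKVg.
Qed.

Lemma group_algebra_mul1r : left_id (group_elt 1%g) group_algebra_mul.
Proof.
move=> f; apply/ffunP=> z; rewrite ffunE (bigD1 1%g) //= ffunE eqxx mul1r.
rewrite invg1 mul1g big1 ?addr0 // => x x1.
by rewrite ffunE (negPf x1) mul0r.
Qed.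

Lemma group_algebra_mulr1 : right_id (group_elt 1%g) group_algebra_mul.
Proof.
move=> f; apply/ffunP=> z; rewrite ffunE (bigD1 z) //= ffunE mulVg eqxx mulr1.
rewrite big1 ?addr0 // => x xz; rewrite ffunE -eq_mulVg1.
by rewrite (negPf xz) mulr0.
Qed.

Lemma group_algebra_mulDl : left_distributive group_algebra_mul +%R.
Proof.
move=> f g h; apply/ffunP=> z; rewrite !ffunE -big_split /=.
by apply: eq_bigr => x _; rewrite ffunE mulrDl.
Qed.

Lemma group_algebra_mulDr : right_distributive group_algebra_mul +%R.
Proof.
move=> f g h; apply/ffunP=> z; rewrite !ffunE -big_split /=.
by apply: eq_bigr => x _; rewrite ffunE mulrDr.
Qed.

Lemma group_elt1_neq0 : group_elt 1%g != 0.
Proof.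
by apply/eqP => /ffunP/(_ 1%g)/eqP; rewrite !ffunE eqxx oner_eq0.
Qed.

HB.instance Definition _ := GRing.Zmodule_isNzRing.Build A
  group_algebra_mulA group_algebra_mul1r group_algebra_mulr1
  group_algebra_mulDl group_algebra_mulDr group_elt1_neq0.

Lemma group_algebra_scaleAl (a : C) (f g : A) : a *: (f * g) = (a *: f) * g.
Proof.
apply/ffunP=> z; rewrite !ffunE scaler_sumr.
by apply: eq_bigr => x _; rewrite ffunE; apply: mulrA.
Qed.

HB.instance Definition _ :=
  GRing.Lmodule_isLalgebra.Build C A group_algebra_scaleAl.

Lemma group_algebra_scaleAr (a : C) (f g : A) : a *: (f * g) = f * (a *: g).
Proof.
apply/ffunP=> z; rewrite !ffunE scaler_sumr.
by apply: eq_bigr => x _; rewrite ffunE; apply: mulrCA.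
Qed.

HB.instance Definition _ :=
  GRing.Lalgebra_isAlgebra.Build C A group_algebra_scaleAr.

Lemma group_eltM (x y : gT) : group_elt (x * y)%g = group_elt x * group_elt y.
Proof.
apply/ffunP=> z; rewrite !ffunE (bigD1 x) //= !ffunE eqxx mul1r.
rewrite big1 ?addr0 => [|w wx]; last by rewrite !ffunE (negPf wx) mul0r.
by rewrite -(inj_eq (mulgI x) _ y) mulKVg.
Qed.

Lemma group_algebra_sum (f : A) : f = \sum_x f x *: group_elt x.
Proof.
apply/ffunP=> z; rewrite sum_ffunE (bigD1 z) //= !ffunE eqxx.
rewrite big1 ?addr0 => [|x xz]; first by rewrite -[LHS]mulr1.
by rewrite !ffunE eq_sym (negPf xz) scaler0.
Qed.

Definition group_star (f : A) : A := \sum_x (f x)^* *: group_elt x^-1%g.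

(* On C, 0 <= z means that z is real and nonnegative. *)
Definition psdmx n (M : 'M[C]_n) : Prop :=
  M ^t* = M /\ forall v : 'cV[C]_n, 0 <= (v ^t* *m M *m v) 0 0.

Definition star_representation n (pi : {lrmorphism A -> 'M[C]_n.+1}) : Prop :=
  (forall x : gT, pi (group_elt x) \is unitarymx) /\
  (forall f : A, pi (group_star f) = (pi f) ^t*).

Definition nonneg_elt (f : A) : Prop :=
  forall n (pi : {lrmorphism A -> 'M[C]_n.+1}),
    star_representation pi -> psdmx (pi f).

(* Matrices with rows and columns indexed by the group, through the canonical
   enumeration of its elements. *)
Local Notation gmatrix := 'M[C]_#|gT|.

Definition gentry (Q : gmatrix) (x y : gT) : C :=
  Q (enum_rank x) (enum_rank y).

Definition gmatrix_of (F : gT -> gT -> C) : gmatrix :=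
  \matrix_(i, j) F (enum_val i) (enum_val j).

Lemma gmatrix_ofE F x y : gentry (gmatrix_of F) x y = F x y.
Proof. by rewrite /gentry mxE !enum_rankK. Qed.

Definition feasible (f : A) (Q : gmatrix) : Prop :=
  [/\ Q ^t* = Q, psdmx Q &
      forall z : gT,
        \sum_(p : gT * gT | (p.1^-1 * p.2)%g == z) gentry Q p.1 p.2 = f z].

(* The two objective values below are real since feasible matrices are
   Hermitian, so the partial order of C compares them as reals. *)
Definition optimal (f : A) (Q : gmatrix) : Prop :=
  feasible f Q /\
  forall Q' : gmatrix, feasible f Q' -> gentry Q' 1%g 1%g <= gentry Q 1%g 1%g.

Definition gram_matrix (h : A) : gmatrix :=
  gmatrix_of (fun x y => h x^-1%g * h y).

End GroupAlgebra.

(* Main.v *)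
From HB Require Import structures.
Require Import Defs.
From mathcomp Require Import all_boot all_order all_fingroup all_algebra.
From mathcomp Require Import reals complex.

(** Everything is transported to matrices through the left regular
representation [regmx], a faithful *-representation, where a nonnegative
element becomes a positive semidefinite matrix.  Conversely [star(k) * k] is
nonnegative in every *-representation, so nonnegativity of a square root need
not be checked eigenvalue by eigenvalue.

Existence.  The matrix of [f] is positive semidefinite, hence some polynomial
[p], interpolating the fourth root on the spectrum, sends it to a Hermitian
fourth root.  Being a polynomial in [f], this root is the matrix of
[k = p(f)]; then [k = star(k)], and [h = k^2 = star(k) * k] is a nonnegative
square root of [f].  Uniqueness is that of the positive semidefinite square
root of a matrix ([psdmx_sqrt_unique]).

Optimality.  Factoring a feasible [Q] as a Gram matrix amounts to writing
[f = sum_i star(g_i) * g_i], with objective value [sum_i |g_i(1)|^2]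
([feasible_sum_star_mul]).  Up to the factor [#|G|], the coefficient at [1] is
the trace of the regular matrix, so the claim becomes: if [H] is positive
semidefinite and [sum_i G_i^* G_i = H^2], then [sum_i |tr G_i|^2 <= (tr H)^2]
([sum_sqr_trace_le]).  In an orthonormal eigenbasis of [H], with eigenvalues
[d_j], stack the [G_i] on top of each other: the constraint says that column
[j] of the stack has norm [d_j], so the vector [u_j] of the [j]-th diagonal
entries of the [G_i] has norm at most [d_j].  The traces are the entries of
[sum_j u_j], whose norm is at most [sum_j d_j = tr H] by the triangle
inequality.  The gram matrix of [h] attains the bound, since its objective
value is [h(1)^2]. *)

Set Implicit Arguments.
Unset Strict Implicit.
Unset Printing Implicit Defensive.

Import Order.TTheory GRing.Theory Num.Theory.
Local Open Scope ring_scope.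
Local Open Scope sesquilinear_scope.

(** * Positive semidefinite matrices *)

Section PositiveSemidefinite.
Variable C : numClosedFieldType.

Lemma trmxC_mul m n p (A : 'M[C]_(m, n)) (B : 'M[C]_(n, p)) :
  (A *m B) ^t* = B ^t* *m A ^t*.
Proof. by rewrite trmx_mul map_mxM. Qed.

Lemma unitarymxC_mulK n (P : 'M[C]_n) : P \is unitarymx -> P ^t* *m P = 1%:M.
Proof. by move=> PU; rewrite -invmx_unitary // mulVmx // unitarymx_unit. Qed.

Lemma mul_trmxC_diag m n (M : 'M[C]_(m, n)) j :
  (M ^t* *m M) j j = \sum_i `|M i j| ^+ 2.
Proof. by rewrite mxE; apply: eq_bigr => i _; rewrite !mxE mulrC normCK. Qed.

Lemma psdmx_gram m n (M : 'M[C]_(m, n)) : psdmx (M ^t* *m M).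
Proof.
split=> [|v]; first by rewrite trmxC_mul trmxCK.
rewrite mulmxA -trmxC_mul -mulmxA mul_trmxC_diag.
by apply: sumr_ge0 => i _; rewrite exprn_ge0.
Qed.

Lemma psdmx_conj m n (P : 'M[C]_(m, n)) (M : 'M[C]_n) :
  psdmx M -> psdmx (P *m M *m P ^t*).
Proof.
case=> Mh M0; split=> [|v]; first by rewrite !trmxC_mul trmxCK Mh mulmxA.
by have := M0 (P ^t* *m v); rewrite trmxC_mul trmxCK !mulmxA.
Qed.

Lemma psdmx_diag_ge0 n (M : 'M[C]_n) j : psdmx M -> 0 <= M j j.
Proof.
case=> _ /(_ (delta_mx j 0)); rewrite trmx_delta map_delta_mx.
by rewrite -rowE -colE !mxE.
Qed.

Lemma hermitian_diagonalization n (M : 'M[C]_n) : M ^t* = M ->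
  exists2 P : 'M[C]_n, P \is unitarymx &
    exists d : 'rV[C]_n, M = P ^t* *m diag_mx d *m P.
Proof.
move=> Mh; exists (spectralmx M); first exact: spectral_unitarymx.
exists (spectral_diag M); rewrite -invmx_unitary ?spectral_unitarymx //.
by apply/orthomx_spectralP/normalmxP; rewrite Mh.
Qed.

Lemma psdmx_diagonalization n (M : 'M[C]_n) : psdmx M ->
  exists2 P : 'M[C]_n, P \is unitarymx &
    exists2 d : 'rV[C]_n, forall j, 0 <= d 0 j & M = P ^t* *m diag_mx d *m P.
Proof.
move=> Mpsd; have [P PU [d Md]] := hermitian_diagonalization (proj1 Mpsd).
exists P => //; exists d => // j.
have := psdmx_diag_ge0 j (psdmx_conj P Mpsd).
rewrite Md !mulmxA (unitarymxP PU) mul1mx -mulmxA (unitarymxP PU) mulmx1.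
by rewrite mxE eqxx mulr1n.
Qed.

Lemma psdmx_factorization n (M : 'M[C]_n) : psdmx M ->
  exists B : 'M[C]_n, M = B ^t* *m B.
Proof.
move=> /psdmx_diagonalization[P _ [d d0 ->]].
exists (diag_mx (map_mx sqrtC d) *m P).
rewrite trmxC_mul mulmxA -[in RHS](mulmxA (P ^t*)); congr (_ *m _ *m _).
rewrite tr_diag_mx map_diag_mx mulmx_diag; congr diag_mx; apply/rowP => j.
by rewrite !mxE /= geC0_conj ?sqrtC_ge0 // -expr2 sqrtCK.
Qed.

(** In an orthonormal eigenbasis of the Hermitian matrix [X = A - B], the
identity [X A + B X = A^2 - B^2 = 0] has diagonal entries
[x_j (a_j + b_j) = 0].  As [a_j] and [b_j] are nonnegative with difference
[x_j], every eigenvalue [x_j] vanishes. *)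
Lemma psdmx_sqrt_unique n (A B : 'M[C]_n) :
  psdmx A -> psdmx B -> A *m A = B *m B -> A = B.
Proof.
move=> Apsd Bpsd AB; apply/eqP; rewrite -subr_eq0; apply/eqP.
have Xh : (A - B) ^t* = A - B.
  by rewrite linearB map_mxB /= (proj1 Apsd) (proj1 Bpsd).
have [P PU [d dE]] := hermitian_diagonalization Xh.
have PK m (M : 'M[C]_(m, n)) : M *m P ^t* *m P = M.
  by rewrite -mulmxA unitarymxC_mulK // mulmx1.
have dE' : diag_mx d = P *m A *m P ^t* - P *m B *m P ^t*.
  rewrite -mulmxBl -mulmxBr dE !mulmxA (unitarymxP PU) mul1mx.
  by rewrite -mulmxA (unitarymxP PU) mulmx1.
have XAB : diag_mx d *m (P *m A *m P ^t*)
         + (P *m B *m P ^t*) *m diag_mx d = 0.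
  rewrite dE' mulmxBl mulmxBr !mulmxA !PK -!(mulmxA P) AB.
  by rewrite subrKA subrr.
suff d0 : d = 0 by rewrite dE d0 linear0 mulmx0 mul0mx.
apply/rowP => j; rewrite mxE.
have := psdmx_diag_ge0 j (psdmx_conj P Apsd).
have := psdmx_diag_ge0 j (psdmx_conj P Bpsd).
move: XAB dE' => /matrixP/(_ j j) + /matrixP/(_ j j).
move: (P *m A *m _) (P *m B *m _) => A' B'.
rewrite mul_mx_diag mul_diag_mx !mxE eqxx mulr1n => e dj b0 a0.
move/eqP: e; rewrite mulrC -mulrDl mulf_eq0 paddr_eq0 //.
by case/orP=> [/andP[/eqP a /eqP b]|/eqP //]; rewrite dj a b subrr.
Qed.

Lemma poly_interpolation (F : fieldType) (s : seq F) (g : F -> F) :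
  exists p : {poly F}, {in s, forall x, p.[x] = g x}.
Proof.
elim: s => [|a s [p ps]]; first by exists 0.
have [as_|as_] := boolP (a \in s).
  by exists p => x; rewrite inE => /predU1P[->|]; apply: ps.
pose q := \prod_(b <- s) ('X - b%:P).
have q0 : q.[a] != 0 by rewrite -/(root q a) root_prod_XsubC.
exists (p + ((g a - p.[a]) / q.[a])%:P * q) => x.
rewrite inE !hornerE => /predU1P[->|xs]; first by rewrite divfK // subrKC.
suff /eqP-> : q.[x] == 0 by rewrite mulr0 addr0 ps.
by rewrite -/(root q x) root_prod_XsubC.
Qed.

Lemma horner_mx_unitary n (P D : 'M[C]_n.+1) p : P \is unitarymx ->
  horner_mx (P ^t* *m D *m P) p = P ^t* *m horner_mx D p *m P.
Proof.
move=> PU; elim/poly_ind: p => [|p c IH].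
  by rewrite !rmorph0 mulmx0 mul0mx.
rewrite !rmorphD !rmorphM /= IH !horner_mx_C !horner_mx_X -!mulmxE.
rewrite mulmxDr mulmxDl !mulmxA mulmxtVK //; congr (_ + _).
by rewrite mul_mx_scalar -scalemxAl unitarymxC_mulK // scalemx1.
Qed.

(** The root is a polynomial in the matrix, so that it stays inside any algebra
of matrices that contains the matrix itself.  It is Hermitian although [p] may
have non-real coefficients, because [p] is real on the spectrum. *)
Lemma psdmx_poly_root n k (M : 'M[C]_n.+1) : (0 < k)%N -> psdmx M ->
  exists p, horner_mx M p ^t* = horner_mx M p /\ horner_mx M p ^+ k = M.
Proof.
move=> k0 /psdmx_diagonalization[P PU [d d0 Md]].
have [p pd] := poly_interpolation [seq d 0 j | j : 'I_n.+1] k.-root.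
have pM : horner_mx M p = P ^t* *m diag_mx (map_mx k.-root d) *m P.
  rewrite Md horner_mx_unitary // horner_mx_diag; congr (_ *m diag_mx _ *m _).
  by apply/rowP => j; rewrite !mxE pd // image_f.
exists p; split.
  rewrite pM !trmxC_mul trmxCK tr_diag_mx map_diag_mx mulmxA.
  congr (_ *m diag_mx _ *m _); apply/rowP => j.
  by rewrite !mxE /= geC0_conj // rootC_ge0.
rewrite -[RHS](horner_mx_X M) -rmorphXn /= Md !horner_mx_unitary //.
rewrite horner_mx_X horner_mx_diag; congr (_ *m diag_mx _ *m _).
apply/rowP => j; rewrite !mxE horner_exp pd ?rootCK //.
by apply: image_f.
Qed.

Lemma sqrt_dnorm_sum_le n (I : finType) (u : I -> 'rV[C]_n) :
  sqrtC (dotmx (\sum_i u i) (\sum_i u i)) <= \sum_i sqrtC (dotmx (u i) (u i)).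
Proof.
elim/big_ind2: _ => [|x a y b xa yb|//]; first by rewrite linear0l sqrtC0.
by apply: le_trans (lerD xa yb); rewrite triangle_lerif.
Qed.

(** The bound behind optimality.  Seen in an eigenbasis of [H], the hypothesis
gives the norm of each column of the stacked matrices [G i]; a trace only sees
one entry per block and column, and the triangle inequality adds these up. *)
Lemma sum_sqr_trace_le n m (H : 'M[C]_n) (G : 'I_m -> 'M[C]_n) :
  psdmx H -> \sum_i (G i) ^t* *m G i = H *m H ->
  \sum_i `|\tr (G i)| ^+ 2 <= (\tr H) ^+ 2.
Proof.
move=> /psdmx_diagonalization[P PU [d d0 Hd]] GH.
have trP (M : 'M[C]_n) : \tr (P *m M *m P ^t*) = \tr M.
  by rewrite mxtrace_mulC mulmxA unitarymxC_mulK // mul1mx.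
pose K i := P *m G i *m P ^t*.
have KE : \sum_i (K i) ^t* *m K i = diag_mx d *m diag_mx d.
  have -> : diag_mx d *m diag_mx d = P *m (H *m H) *m P ^t*.
    have PH : P *m H = diag_mx d *m P.
      by rewrite Hd !mulmxA (unitarymxP PU) mul1mx.
    by rewrite mulmxA PH -(mulmxA _ P H) PH mulmxA mulmxtVK.
  rewrite -GH mulmx_sumr mulmx_suml; apply: eq_bigr => i _.
  rewrite !trmxC_mul trmxCK !mulmxA -(mulmxA _ (P ^t*)).
  by rewrite unitarymxC_mulK // mulmx1.
(* The diagonal entries met by column [j] of the stack of the [K i]. *)
pose u j : 'rV[C]_m := \row_i K i j j.
have dot_row (v : 'rV[C]_m) : dotmx v v = \sum_i `|v 0 i| ^+ 2.
  by rewrite dotmxE mxE; apply: eq_bigr => i _; rewrite !mxE normCK.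
have u_le j : sqrtC (dotmx (u j) (u j)) <= d 0 j.
  rewrite -[leRHS](sqrCK (d0 j)) ler_sqrtC ?nnegrE ?exprn_ge0 //; last first.
    by rewrite dot_row sumr_ge0 // => i _; rewrite exprn_ge0.
  move/matrixP/(_ j j): KE; rewrite mul_diag_mx !mxE eqxx mulr1n -expr2 => <-.
  rewrite dot_row summxE; apply: ler_sum => i _.
  rewrite mul_trmxC_diag mxE (bigD1 j) //= lerDl.
  by apply: sumr_ge0 => k _; rewrite exprn_ge0.
have -> : \sum_i `|\tr (G i)| ^+ 2 = dotmx (\sum_j u j) (\sum_j u j).
  rewrite dot_row; apply: eq_bigr => i _; rewrite -trP summxE.
  by under [in RHS]eq_bigr do rewrite mxE.
have -> : \tr H = \sum_j d 0 j.
  by rewrite Hd mxtrace_mulC mulmxA (unitarymxP PU) mul1mx mxtrace_diag.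
rewrite -[leLHS]sqrtCK lerXn2r // ?nnegrE ?sqrt_dnorm_ge0 ?sumr_ge0 //.
by apply: le_trans (sqrt_dnorm_sum_le u) _; apply: ler_sum.
Qed.

End PositiveSemidefinite.

(** * The left regular representation *)

Section RegularRepresentation.
Variables (C : numClosedFieldType) (gT : finGroupType).
Local Notation A := (group_algebra C gT).

Lemma group_starE (f : A) x : group_star f x = (f x^-1%g)^*.
Proof.
rewrite sum_ffunE (bigD1 x^-1%g) //= big1 ?addr0 => [|y yx].
  by rewrite !ffunE invgK eqxx; apply: mulr1.
rewrite -(inj_eq invg_inj) invgK eq_sym in yx.
by rewrite !ffunE (negPf yx) scaler0.
Qed.

Lemma group_algebra_mulE (f g : A) z : (f * g) z = \sum_x f x * g (x^-1 * z)%g.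
Proof. by rewrite ffunE. Qed.

Local Notation n := #|gT|.-1.

Lemma group_card_succ : n.+1 = #|gT|.
Proof. by rewrite prednK // (cardD1 1%g). Qed.

Definition group_val (i : 'I_n.+1) : gT :=
  enum_val (cast_ord group_card_succ i).

Lemma group_val_bij : bijective group_val.
Proof.
exists (fun x => cast_ord (esym group_card_succ) (enum_rank x)) => x.
  by rewrite /group_val enum_valK cast_ordK.
by rewrite /group_val cast_ordKV enum_rankK.
Qed.

(** Left multiplication by [f] sends [y] to [sum_x f(x y^-1) x].  The size is
written as a successor because *-representations take values in nontrivial
matrix rings. *)
Definition regmx (f : A) : 'M[C]_n.+1 :=
  \matrix_(i, j) f (group_val i * (group_val j)^-1)%g.

Lemma regmx_linear : linear regmx.
Proof. by move=> a f g; apply/matrixP => i j; rewrite !mxE !ffunE. Qed.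

Lemma regmx_monoid_morphism : monoid_morphism regmx.
Proof.
split=> [|f g]; apply/matrixP => i j.
  by rewrite !mxE ffunE -eq_mulgV1 (bij_eq group_val_bij).
rewrite !mxE group_algebra_mulE.
rewrite (reindex_inj (mulgI (group_val i))) (reindex_inj invg_inj) /=.
rewrite (reindex group_val) /=; last exact/onW_bij/group_val_bij.
by apply: eq_bigr => k _; rewrite !mxE invMg invgK !mulgA mulgKV.
Qed.

HB.instance Definition _ :=
  GRing.isLinear.Build C A 'M[C]_n.+1 *:%R regmx regmx_linear.
HB.instance Definition _ :=
  GRing.isMonoidMorphism.Build A 'M[C]_n.+1 regmx regmx_monoid_morphism.

Lemma regmx_inj : injective regmx.
Proof.
have [r _ rK] := group_val_bij.
move=> f g /matrixP fg; apply/ffunP => x.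
by have := fg (r x) (r 1%g); rewrite !mxE !rK invg1 mulg1.
Qed.

Lemma regmx_star f : regmx (group_star f) = regmx f ^t*.
Proof. by apply/matrixP => i j; rewrite !mxE group_starE invMg invgK. Qed.

Lemma group_star_elt x :
  group_star (@group_elt C gT x) = @group_elt C gT x^-1%g.
Proof.
apply/ffunP => y; rewrite group_starE !ffunE rmorph_nat.
by rewrite -(inj_eq invg_inj) invgK.
Qed.

Lemma regmx_star_representation : star_representation regmx.
Proof.
split=> [x|f]; last exact: regmx_star.
apply/unitarymxP; rewrite /= -regmx_star mulmxE -rmorphM group_star_elt.
by rewrite -group_eltM mulgV rmorph1.
Qed.

Lemma psd_regmx f : nonneg_elt f -> psdmx (regmx f).
Proof. by move=> f0; apply: f0 regmx_star_representation. Qed.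

Lemma mxtrace_regmx f : \tr (regmx f) = #|gT|%:R * f 1%g.
Proof.
rewrite /mxtrace; under eq_bigr do rewrite mxE mulgV.
by rewrite sumr_const card_ord group_card_succ mulr_natl.
Qed.

(** * Nonnegative square roots in the group algebra *)

Lemma nonneg_elt_star_mul (f : A) : nonneg_elt (group_star f * f).
Proof. by move=> m pi [_ piS]; rewrite rmorphM /= piS; apply: psdmx_gram. Qed.

(** A fourth root [k] is taken rather than a square root so that [h = k^2] is of
the form [star(k) * k], hence nonnegative in all *-representations at once. *)
Lemma nonneg_elt_sqrt_exists (f : A) : nonneg_elt f ->
  exists h, [/\ nonneg_elt h, h = group_star h & f = h ^+ 2].
Proof.
move=> /psd_regmx /(psdmx_poly_root (isT : 0 < 4)%N) [p [ph p4]].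
pose k := horner_alg f p.
have kE : regmx k = horner_mx (regmx f) p.
  rewrite /k; elim/poly_ind: p {ph p4 k} => [|p c IH].
    by rewrite !rmorph0.
  rewrite !rmorphD !rmorphM /= IH horner_algX horner_mx_X horner_algC.
  by rewrite horner_mx_C linearZ rmorph1 /= scalemx1.
have ks : group_star k = k by apply: regmx_inj; rewrite regmx_star kE.
exists (k ^+ 2); split.
- by rewrite expr2 -{1}ks; apply: nonneg_elt_star_mul.
- apply: regmx_inj.
  by rewrite regmx_star expr2 rmorphM /= trmxC_mul -regmx_star ks.
- by apply: regmx_inj; rewrite -exprM rmorphXn /= kE p4.
Qed.

Lemma nonneg_elt_sqrt_unique (h k : A) :
  nonneg_elt h -> nonneg_elt k -> h ^+ 2 = k ^+ 2 -> h = k.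
Proof.
move=> /psd_regmx h0 /psd_regmx k0 hk; apply: regmx_inj.
by apply: psdmx_sqrt_unique => //; rewrite !mulmxE -!rmorphM /= -!expr2 hk.
Qed.

(** * The optimization problem *)

Lemma star_coef_inv (h : A) x : h = group_star h -> h x^-1%g = (h x)^*.
Proof. by move=> {1}->; rewrite group_starE invgK. Qed.

Lemma sum_left_quotient (F : gT -> gT -> C) z :
  \sum_(p : gT * gT | (p.1^-1 * p.2)%g == z) F p.1 p.2
    = \sum_x F x (x * z)%g.
Proof.
rewrite (reindex (fun x => (x, x * z)%g)) /=.
  by apply: eq_bigl => x; rewrite mulKg eqxx.
exists fst => [x _|[x y]] //=; rewrite inE => /eqP/= <-.
by rewrite mulKVg.
Qed.

Lemma gram_matrix_feasible (h : A) :
  h = group_star h -> feasible (h ^+ 2) (gram_matrix h).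
Proof.
move=> hs; have psd : psdmx (gram_matrix h).
  pose u : 'rV[C]_#|gT| := \row_j h (enum_val j).
  suff -> : gram_matrix h = u ^t* *m u by apply: psdmx_gram.
  by apply/matrixP => i j; rewrite !mxE big_ord1 !mxE (star_coef_inv _ hs).
split=> // [|z]; first exact: proj1 psd.
under eq_bigr do rewrite gmatrix_ofE.
rewrite (sum_left_quotient (fun x y => h x^-1%g * h y)) expr2.
rewrite group_algebra_mulE (reindex_inj invg_inj) /=.
by apply: eq_bigr => x _; rewrite !invgK.
Qed.

(** A factorization [Q = B^* B] turns the linear constraints on [Q] into a
decomposition of [f] as a sum of hermitian squares; the summands are the rows
of [B] read as elements of the group algebra. *)
Lemma feasible_sum_star_mul (f : A) Q : feasible f Q ->
  exists m (g : 'I_m -> A), f = \sum_i group_star (g i) * g i /\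
    gentry Q 1%g 1%g = \sum_i `|g i 1%g| ^+ 2.
Proof.
case=> _ /psdmx_factorization[B QB] Qf.
pose g i : A := [ffun x => B i (enum_rank x)].
have QE x y : gentry Q x y = \sum_i (g i x)^* * g i y.
  by rewrite /gentry QB mxE; apply: eq_bigr => i _; rewrite !mxE !ffunE.
exists _, g; split; last first.
  by rewrite QE; apply: eq_bigr => i _; rewrite mulrC normCK.
apply/ffunP => z; rewrite -Qf sum_left_quotient sum_ffunE.
under eq_bigr do rewrite QE; rewrite exchange_big; apply: eq_bigr => i _.
rewrite group_algebra_mulE [RHS](reindex_inj invg_inj) /=.
by apply: eq_bigr => x _; rewrite group_starE !invgK.
Qed.

Lemma gram_matrix_optimal (h : A) : nonneg_elt h -> h = group_star h ->
  optimal (h ^+ 2) (gram_matrix h).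
Proof.
move=> h0 hs; split; first exact: gram_matrix_feasible.
move=> Q /feasible_sum_star_mul[m [g [hg ->]]].
rewrite gmatrix_ofE invg1 -expr2.
have := @sum_sqr_trace_le _ _ m (regmx h) (fun i => regmx (g i)) (psd_regmx h0).
have -> : \sum_i (regmx (g i)) ^t* *m regmx (g i) = regmx h *m regmx h.
  rewrite mulmxE -rmorphM /= -expr2 hg raddf_sum /=; apply: eq_bigr => i _.
  by rewrite rmorphM /= regmx_star.
move=> /(_ erefl); rewrite mxtrace_regmx exprMn.
under eq_bigr do rewrite mxtrace_regmx normrM exprMn normr_nat.
by rewrite -mulr_sumr ler_pM2l // exprn_gt0 // ltr0n -group_card_succ.
Qed.

End RegularRepresentation.

Local Open Scope complex_scope.

Theorem theorem3p8 (R : realType) (gT : finGroupType)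
    (f : group_algebra R[i] gT) (f_ge0 : nonneg_elt f) :
  (exists! h : group_algebra R[i] gT,
     [/\ nonneg_elt h, h = group_star h & f = h ^+ 2]) /\
  (forall h : group_algebra R[i] gT,
     [/\ nonneg_elt h, h = group_star h & f = h ^+ 2] ->
     optimal f (gram_matrix h)).
Proof.
split; last by move=> h [h0 hs ->]; apply: gram_matrix_optimal.
have [h [h0 hs fh]] := nonneg_elt_sqrt_exists f_ge0.
exists h; split=> // k [k0 _ fk].
by apply: nonneg_elt_sqrt_unique; rewrite // -fh.
Qed.
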